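(* Let $n\ge2$. For $T_1$ and $T_2$ in some interval in $\mathscr{C}_n$, their meet and join in $\mathscr{C}_n$ coincide, respectively, with their meet and join in the Tamari lattice $\mathscr{T}_n$.
   Context: $\mathbb{T}_n$ is the set of all full plane binary trees with $n$ leaves (every internal vertex has exactly a left child and a right child); the leaves are labeled $a_1,\ldots,a_n$ from left to right. For $T\in\mathbb{T}_n$, the reduced parenthesization $RP_T$ is the set of all subsets of $\{a_1,\ldots,a_n\}$ which are leaf sets of the subtrees of $T$ rooted at vertices of $T$ and which do not contain $a_n$. The (right) comb poset $\mathscr{C}_n$ is the set $\mathbb{T}_n$ ordered by $T_1\le T_2$ if and only if $RP_{T_1}\subseteq RP_{T_2}$. It has a least element (the right comb tree $a_1(a_2(\cdots(a_{n-1}a_n)\cdots))$), so two trees lie in a common interval exactly when they have a common upper bound in $\mathscr{C}_n$. A left rotation at a vertex $r$ of a tree replaces the subtree rooted at $r$ of the form $(A(BC))$ by $((AB)C)$, where $A,B,C$ are subtrees. The Tamari lattice $\mathscr{T}_n$ is $\mathbb{T}_n$ with the partial order that is the reflexive transitive closure of: $T<T'$ if $T'$ is obtained from $T$ by a left rotation at some vertex (so the right comb tree is its least element). *)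

(* Defs.v *)
From Stdlib Require Export Relation_Operators.
From mathcomp Require Export all_boot.

Set Implicit Arguments.
Unset Strict Implicit.
Unset Printing Implicit Defensive.

Inductive bintree : Type :=
| Leaf
| Node of bintree & bintree.

Fixpoint nleaves (t : bintree) : nat :=
  if t is Node l r then nleaves l + nleaves r else 1.

Definition ptree (n : nat) : Type := {t : bintree | nleaves t == n}.

(* The leaf a_(i+1) is encoded by i : 'I_n.  A vertex of a tree whose leftmost
   leaf has index k is represented by the pair (index of the leftmost leaf
   below the vertex, subtree rooted at the vertex). *)
Fixpoint vertices (k : nat) (t : bintree) : seq (nat * bintree) :=
  (k, t) :: (if t is Node l r
             then vertices k l ++ vertices (k + nleaves l) r
             else [::]).

Definition leafset (n : nat) (v : nat * bintree) : {set 'I_n} :=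
  [set i : 'I_n | v.1 <= i < v.1 + nleaves v.2].

(* The last leaf a_n is the i : 'I_n with i.+1 = n. *)
Definition RP (n : nat) (T : ptree n) : {set {set 'I_n}} :=
  [set S in [seq leafset n v | v <- vertices 0 (val T)]
     | [forall i in S, i.+1 != n]].

Definition comb_le (n : nat) (T1 T2 : ptree n) : Prop := RP T1 \subset RP T2.

Inductive left_rotation : bintree -> bintree -> Prop :=
| rotation_here A B C :
    left_rotation (Node A (Node B C)) (Node (Node A B) C)
| rotation_left l l' r :
    left_rotation l l' -> left_rotation (Node l r) (Node l' r)
| rotation_right l r r' :
    left_rotation r r' -> left_rotation (Node l r) (Node l r').

Definition tamari_le (n : nat) : ptree n -> ptree n -> Prop :=
  clos_refl_trans (ptree n) (fun T T' => left_rotation (val T) (val T')).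

Definition is_meet (X : Type) (le : X -> X -> Prop) (x y m : X) : Prop :=
  [/\ le m x, le m y & forall z, le z x -> le z y -> le z m].

Definition is_join (X : Type) (le : X -> X -> Prop) (x y j : X) : Prop :=
  [/\ le x j, le y j & forall z, le x z -> le y z -> le j z].

(* Main.v *)
(** Cutting a tree along its right spine turns RP_T into the family of all leaf
    intervals of a forest whose last tree is a_n.  If T <= B in the comb poset,
    this forest is obtained from B by repeatedly replacing a tree by its two
    children; such cuts of B form a lattice, in which meets and joins intersect
    and unite the interval families.

    In the Tamari order, T <= T' holds iff the size of the largest subtree ending
    at a_j is at most as large in T as in T', for every j < n.  The subtrees of B
    ending at a_j form a chain, of which each cut keeps an initial segment; hence
    meets and joins of cuts take the minimum and maximum of these sizes, and are
    therefore also the Tamari meets and joins. *)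

From mathcomp Require Import zify.
Require Import Defs.

Set Implicit Arguments.
Unset Strict Implicit.
Unset Printing Implicit Defensive.

(** * Leaf counts and left subtree sizes *)

Lemma nleaves_gt0 t : 0 < nleaves t.
Proof. by elim: t => //= l IHl r IHr; rewrite addn_gt0 IHl. Qed.

Lemma nleaves_eq1 t : nleaves t = 1 -> t = Leaf.
Proof. by case: t => //= l r; have := nleaves_gt0 l; have := nleaves_gt0 r; lia. Qed.

(* In order, the sizes of the left subtrees of the internal vertices: entry j is
   the size of the largest subtree whose last leaf is the j-th one; the last leaf
   of [t] has no entry. *)
Fixpoint left_sizes (t : bintree) : seq nat :=
  if t is Node l r then left_sizes l ++ nleaves l :: left_sizes r else [::].

Lemma size_left_sizes t : (size (left_sizes t)).+1 = nleaves t.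
Proof. by elim: t => //= l IHl r IHr; rewrite size_cat /= -IHl -IHr; lia. Qed.

Lemma size_left_sizes_ptree n (T : ptree n) : size (left_sizes (val T)) = n.-1.
Proof. by have := size_left_sizes (val T); rewrite (eqP (valP T)); lia. Qed.

Lemma nth_left_sizes_le t i : nth 0 (left_sizes t) i <= i.+1.
Proof.
elim: t i => [|l IHl r IHr] i /=; first by rewrite nth_nil.
rewrite nth_cat; case: ltnP => // le_i.
case e: (i - _) => [|j] /=; first by have := size_left_sizes l; lia.
by have := IHr j; lia.
Qed.

(** * Chains of rotations and entrywise comparison of left sizes *)

Definition rotations : bintree -> bintree -> Prop :=
  clos_refl_trans bintree left_rotation.

Lemma rotations_left l l' r : rotations l l' -> rotations (Node l r) (Node l' r).
Proof.
elim=> [x y xy|x|x y z _ xy _ yz].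
- exact/rt_step/rotation_left.
- exact: rt_refl.
- exact: rt_trans xy yz.
Qed.

Lemma rotations_right l r r' : rotations r r' -> rotations (Node l r) (Node l r').
Proof.
elim=> [x y xy|x|x y z _ xy _ yz].
- exact/rt_step/rotation_right.
- exact: rt_refl.
- exact: rt_trans xy yz.
Qed.

Lemma left_rotation_nleaves t t' : left_rotation t t' -> nleaves t = nleaves t'.
Proof. by elim=> [A B C|l l' r _ /= ->|l r r' _ /= ->] //=; rewrite addnA. Qed.

Lemma rotations_nleaves t t' : rotations t t' -> nleaves t = nleaves t'.
Proof. by elim=> [x y /left_rotation_nleaves|//|x y z _ -> _ ->]. Qed.

Lemma nth_cat_le (s1 s2 u1 u2 : seq nat) : size s1 = size s2 ->
    (forall i, nth 0 s1 i <= nth 0 s2 i) ->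
    (forall i, nth 0 u1 i <= nth 0 u2 i) ->
  forall i, nth 0 (s1 ++ u1) i <= nth 0 (s2 ++ u2) i.
Proof. by move=> es s12 u12 i; rewrite !nth_cat es; case: ifP. Qed.

(** Rotating [A (B C)] to [(A B) C] changes a single entry: at the last leaf of [B] it grows from
    [nleaves B] to [nleaves A + nleaves B]. *)
Lemma left_rotation_left_sizes t t' : left_rotation t t' ->
  forall i, nth 0 (left_sizes t) i <= nth 0 (left_sizes t') i.
Proof.
elim=> [A B C|l l' r ll' IH|l r r' rr' IH] /=.
- rewrite -catA /=; apply: nth_cat_le => // -[|i] //=; move: i.
  by apply: nth_cat_le => // -[|i] //=; apply: leq_addl.
- have el := left_rotation_nleaves ll'; rewrite el.
  by apply: nth_cat_le => //; have := size_left_sizes l; have := size_left_sizes l'; lia.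
- by apply: nth_cat_le => // -[].
Qed.

Lemma rotations_left_sizes t t' : rotations t t' ->
  forall i, nth 0 (left_sizes t) i <= nth 0 (left_sizes t') i.
Proof.
elim=> [x y /left_rotation_left_sizes|//|x y z _ xy _ yz] // i.
exact: leq_trans (xy i) (yz i).
Qed.

(** Serves antisymmetry of the Tamari order: a cycle of rotations would make this sum exceed
    itself. *)
Lemma left_rotation_sumn t t' :
  left_rotation t t' -> sumn (left_sizes t) < sumn (left_sizes t').
Proof.
elim=> [A B C|l l' r ll' IH|l r r' _ IH] /=; rewrite ?(sumn_cat, =^~ catA) /=.
- by rewrite !sumn_cat /=; have := nleaves_gt0 A; lia.
- by rewrite (left_rotation_nleaves ll'); lia.
- by lia.
Qed.

Lemma rotations_sumn t t' :
  rotations t t' -> t = t' \/ sumn (left_sizes t) < sumn (left_sizes t').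
Proof.
elim=> [x y /left_rotation_sumn|x|x y z _ xy _ yz]; [by right|by left|].
by case: xy yz => [<-//|xy] [<-|yz]; right; lia.
Qed.

(* The bound on [s2] says that no left subtree straddles the cut point, so the cut
   lies on the right spine and rotations along that spine bring it to the root. *)
Lemma rotations_split t s1 x s2 : left_sizes t = s1 ++ x :: s2 ->
    (forall i, nth 0 s2 i <= i.+1) ->
  exists l r, [/\ rotations t (Node l r), left_sizes l = s1 & left_sizes r = s2].
Proof.
elim: t s1 => [|l IHl r IHr] s1 /=; first by case: s1.
move=> e s2_le; have sl := size_left_sizes l.
have es := congr1 size e; rewrite !size_cat /= in es.
case: (ltngtP (size (left_sizes l)) (size s1)) => sls1.
(* The root's entry precedes the cut: split [r] first, then rotate once at the root. *)
- have e1 := congr1 (drop (size (left_sizes l))) e.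
  have e2 := congr1 (take (size (left_sizes l))) e.
  rewrite drop_size_cat // drop_cat sls1 in e1.
  rewrite take_size_cat // take_cat sls1 in e2.
  case ds: (drop _ s1) e1 => [|y s1'] /=.
    by have := congr1 size ds; rewrite size_drop /=; lia.
  case=> ey er; have [l' [r' [rot el' er']]] := IHr _ er s2_le.
  exists (Node l l'), r'; split => //=.
    apply: rt_trans (rotations_right l rot) _; exact/rt_step/rotation_here.
  by rewrite el' e2 ey -ds cat_take_drop.
(* The root's entry follows the cut, but [nleaves l] reaches back to the first leaf and so exceeds
   the bound on [s2]. *)
- have e1 := congr1 (drop (size s1).+1) e.
  rewrite drop_cat -(cat_rcons x s1) drop_size_cat ?size_rcons // in e1.
  case: ltnP e1 => slt e1; last first.
    have s0 : (size s1).+1 - size (left_sizes l) = 0 by lia.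
    by have := s2_le 0; rewrite -e1 s0 /= => h; lia.
  have := s2_le (size (left_sizes l) - (size s1).+1).
  by rewrite -e1 nth_cat size_drop ltnn subnn /=; lia.
- have /eqP := e; rewrite eqseq_cat // => /andP[/eqP el /eqP[_ er]].
  by exists l, r; split => //; apply: rt_refl.
Qed.

(** Induction on [t']. Beyond the root position [p] of [t'], the entries of [t] are bounded by those
    of [r'], so [rotations_split] brings position [p] to the root of [t]; the two halves then
    compare with [l'] and [r']. *)
Lemma left_sizes_rotations t t' : nleaves t = nleaves t' ->
  (forall i, nth 0 (left_sizes t) i <= nth 0 (left_sizes t') i) -> rotations t t'.
Proof.
elim: t' t => [|l' IHl r' IHr] t.
  by move=> /nleaves_eq1-> _; apply: rt_refl.
set p := size (left_sizes l') => /= et le_t.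
have sl := size_left_sizes l'; have sr := size_left_sizes r'.
have st := size_left_sizes t; have lt_p : p < size (left_sizes t) by lia.
have le_l i : i < p -> nth 0 (left_sizes t) i <= nth 0 (left_sizes l') i.
  by move=> ip; have := le_t i; rewrite nth_cat ip.
have le_r i : nth 0 (drop p.+1 (left_sizes t)) i <= nth 0 (left_sizes r') i.
  rewrite nth_drop; have := le_t (p.+1 + i); rewrite nth_cat ltnNge.
  have -> : p <= p.+1 + i by lia.
  by have -> /= : p.+1 + i - size (left_sizes l') = i.+1 by rewrite -/p; lia.
have [||l [r [rot el er]]] := @rotations_split t (take p (left_sizes t))
    (nth 0 (left_sizes t) p) (drop p.+1 (left_sizes t)).
- by rewrite -drop_nth ?cat_take_drop.
- by move=> i; apply: leq_trans (le_r i) (nth_left_sizes_le _ _).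
apply: rt_trans rot _; apply: rt_trans (rotations_left r _) (rotations_right l' _).
- apply: IHl => [|i].
    by rewrite -size_left_sizes el size_takel //; exact: ltnW.
  rewrite el; case: (ltnP i p) => ip; first by rewrite nth_take ?le_l.
  by rewrite nth_default // size_takel //; exact: ltnW.
- apply: IHr => [|i]; last by rewrite er.
  by rewrite -size_left_sizes er size_drop; lia.
Qed.

(** * The Tamari order on trees with [n] leaves *)

Section TamariOrder.
Variable n : nat.
Implicit Types T : ptree n.

Lemma rotations_tamari_le T T' : rotations (val T) (val T') -> tamari_le T T'.
Proof.
have gen t t' : rotations t t' ->
    forall T T', val T = t -> val T' = t' -> tamari_le T T'; last by move/gen; apply.
elim=> [x y xy|x|x y z xy IHxy _ IHyz] {}T {}T' eT eT'.
- by apply: rt_step; rewrite eT eT'.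
- by rewrite (_ : T' = T) ?eT; [apply: rt_refl|apply: val_inj; rewrite eT].
(* Rotations keep the leaf count, so the intermediate tree is again a [ptree n]. *)
- have ny : nleaves y == n by rewrite -(rotations_nleaves xy) -eT (valP T).
  by apply: rt_trans (IHxy T (exist _ y ny) _ _) (IHyz _ T' _ _).
Qed.

Lemma tamari_le_rotations T T' : tamari_le T T' -> rotations (val T) (val T').
Proof.
elim=> [x y xy|x|x y z _ xy _ yz]; first exact: rt_step.
- exact: rt_refl.
- exact: rt_trans xy yz.
Qed.

Lemma tamari_leP T T' : tamari_le T T' <->
  forall i, nth 0 (left_sizes (val T)) i <= nth 0 (left_sizes (val T')) i.
Proof.
split=> [/tamari_le_rotations/rotations_left_sizes//|le].
apply: rotations_tamari_le; apply: left_sizes_rotations => //.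
by rewrite (eqP (valP T)) (eqP (valP T')).
Qed.

Lemma tamari_le_anti T T' : tamari_le T T' -> tamari_le T' T -> T = T'.
Proof.
move=> /tamari_le_rotations/rotations_sumn [/val_inj//|lt1].
by move=> /tamari_le_rotations/rotations_sumn [/val_inj//|lt2]; lia.
Qed.

End TamariOrder.

(** * Leaf intervals of trees and forests *)

(* A pair (i, s) stands for the leaf interval [i, i + s). *)
Definition intervals (k : nat) (t : bintree) : seq (nat * nat) :=
  [seq (v.1, nleaves v.2) | v <- vertices k t].

Lemma intervals_node k l r :
  intervals k (Node l r) =
  (k, nleaves l + nleaves r) :: intervals k l ++ intervals (k + nleaves l) r.
Proof. by rewrite /intervals /= map_cat. Qed.

Lemma mem_intervals_bounds k t (p : nat * nat) : p \in intervals k t ->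
  [/\ k <= p.1, 0 < p.2 & p.1 + p.2 <= k + nleaves t].
Proof.
elim: t k => [|l IHl r IHr] k; first by rewrite inE => /eqP->.
rewrite intervals_node inE mem_cat /= => /or3P[/eqP->|/IHl|/IHr] /=.
- by have := nleaves_gt0 l; split; lia.
- by case=> *; split; lia.
- by case=> *; split; lia.
Qed.

Notation fleaves f := (sumn [seq nleaves t | t <- f]).

Fixpoint fintervals (k : nat) (f : seq bintree) : seq (nat * nat) :=
  if f is t :: f' then intervals k t ++ fintervals (k + nleaves t) f' else [::].

Lemma fintervals1 k t : fintervals k [:: t] = intervals k t.
Proof. exact: cats0. Qed.

Lemma fintervals_cat k f g :
  fintervals k (f ++ g) = fintervals k f ++ fintervals (k + fleaves f) g.
Proof. by elim: f k => [|t f IH] k /=; rewrite ?addn0 // IH catA addnA. Qed.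

Lemma mem_fintervals_bounds k f (p : nat * nat) : p \in fintervals k f ->
  [/\ k <= p.1, 0 < p.2 & p.1 + p.2 <= k + fleaves f].
Proof.
elim: f k => //= t f IH k; rewrite mem_cat => /orP[/mem_intervals_bounds|/IH].
  by case=> *; split; lia.
by case=> *; split; lia.
Qed.

(** Forest analogue of [left_sizes]; the last leaf of each tree gets an entry too, the size of that
    tree. *)
Definition fsizes (f : seq bintree) : seq nat :=
  flatten [seq rcons (left_sizes t) (nleaves t) | t <- f].

Lemma size_fsizes f : size (fsizes f) = fleaves f.
Proof.
by elim: f => //= t f IH; rewrite size_cat size_rcons size_left_sizes -IH.
Qed.

Lemma fsizes_cat f g : fsizes (f ++ g) = fsizes f ++ fsizes g.
Proof. by rewrite /fsizes map_cat flatten_cat. Qed.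

(** * Cuts of a tree *)

(* The forests obtained from [t] by repeatedly replacing a tree by its children. *)
Inductive cut : seq bintree -> bintree -> Prop :=
| cut_one t : cut [:: t] t
| cut_node f g l r : cut f l -> cut g r -> cut (f ++ g) (Node l r).

Lemma cut_fleaves f t : cut f t -> fleaves f = nleaves t.
Proof.
by elim=> [u|{}f g l r _ IHf _ IHg] /=; rewrite ?addn0 // map_cat sumn_cat IHf IHg.
Qed.

Lemma cut_nnil f t : cut f t -> 0 < size f.
Proof. by elim=> // {}f g l r _ IHf _ _; rewrite size_cat ltn_addr. Qed.

Lemma cut_inv f l r : cut f (Node l r) ->
  f = [:: Node l r] \/ exists f1 f2, [/\ f = f1 ++ f2, cut f1 l & cut f2 r].
Proof.
move et: (Node l r) => t c.
case: c et => [u _|f1 f2 l' r' c1 c2 [-> ->]]; first by left.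
by right; exists f1, f2.
Qed.

Lemma cut1 t u : cut [:: t] u -> t = u.
Proof.
case: u => [|l r] c.
  by apply: nleaves_eq1; rewrite -[RHS](cut_fleaves c) /= addn0.
case: (cut_inv c) => [[]//|[f1 [f2 [/(congr1 size) + /cut_nnil + /cut_nnil]]]].
by rewrite size_cat /=; lia.
Qed.

Lemma cut_fintervals k f t : cut f t -> {subset fintervals k f <= intervals k t}.
Proof.
move=> c; elim: c k => [{}t|{}f g l r cf IHf _ IHg] k p; first by rewrite fintervals1.
rewrite fintervals_cat intervals_node inE !mem_cat (cut_fleaves cf).
by case/orP=> [/IHf|/IHg] ->; rewrite !orbT.
Qed.

(** Replacing [Node l r] by its children changes one entry: at the last leaf it drops from
    [nleaves l + nleaves r] to [nleaves r]. *)
Lemma cut_fsizes_le f t : cut f t ->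
  forall i, nth 0 (fsizes f) i <= nth 0 (fsizes [:: t]) i.
Proof.
elim=> // {}f g l r cf IHf _ IHg i; rewrite fsizes_cat.
have sz h u : cut h u -> size (fsizes h) = size (fsizes [:: u]).
  by move=> c; rewrite !size_fsizes (cut_fleaves c) /= addn0.
apply: leq_trans (nth_cat_le (sz _ _ cf) IHf IHg i) _.
rewrite /fsizes /= !cats0 rcons_cat cat_rcons /=.
apply: nth_cat_le => // -[|j] //=; rewrite -!cats1.
by apply: nth_cat_le => // -[|] //=; apply: leq_addl.
Qed.

(** As long as [c] is not reached, the first tree must end by [c], since otherwise its own interval
    would straddle [c]. *)
Lemma fsplit k c f : k <= c <= k + fleaves f ->
    (forall p : nat * nat, p \in fintervals k f -> p.1 + p.2 <= c \/ c <= p.1) ->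
  exists f1 f2, f = f1 ++ f2 /\ k + fleaves f1 = c.
Proof.
elim: f k => [|t f IH] k /= kc nstr; first by exists [::], [::]; split => //=; lia.
have [ek|ltkc] := eqVneq k c; first by exists [::], (t :: f); rewrite /= addn0.
have kt : (k, nleaves t) \in intervals k t ++ fintervals (k + nleaves t) f.
  by case: (t) => [|l r]; rewrite inE eqxx.
have [/= le_tc|/= le_ck] := nstr _ kt; last by lia.
have [||f1 [f2 [-> e2]]] := IH (k + nleaves t); first by lia.
  by move=> p pf; apply: nstr; rewrite mem_cat pf orbT.
by exists (t :: f1), f2; split => //=; lia.
Qed.

(** Converse of [cut_fintervals]. With two or more trees no interval is the full one, so each lies
    under [l] or under [r]; the forest splits at their boundary and induction applies to both
    parts. *)
Lemma fintervals_cut k f t : fleaves f = nleaves t ->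
  {subset fintervals k f <= intervals k t} -> cut f t.
Proof.
elim: t k f => [|l IHl r IHr] k f.
  case: f => [|t [|u f]] //=; last first.
    by have := nleaves_gt0 t; have := nleaves_gt0 u; lia.
  by rewrite addn0 => /nleaves_eq1-> _; apply: cut_one.
have many g : 1 < size g -> fleaves g = nleaves (Node l r) ->
    {subset fintervals k g <= intervals k (Node l r)} ->
    exists g1 g2, [/\ g = g1 ++ g2, cut g1 l & cut g2 r].
  move=> g2 eg sub.
  have {}sub (p : nat * nat) : p \in fintervals k g ->
      (p \in intervals k l) || (p \in intervals (k + nleaves l) r).
    move=> pg; have := sub _ pg; rewrite intervals_node inE mem_cat.
    case/orP=> // /eqP ep; exfalso; move: g2 eg pg; rewrite {p}ep.
    case: g {sub} => [|t [|u g]] //= _ eg; rewrite mem_cat.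
    move=> pg; have := nleaves_gt0 t; have := nleaves_gt0 u; case/orP: pg.
      by move/mem_intervals_bounds => /= [*]; lia.
    by move/(@mem_fintervals_bounds _ (u :: g)) => /= [*]; lia.
  have [||g1 [g3 [eg' eg1]]] := @fsplit k (k + nleaves l) g.
  - by rewrite eg /=; lia.
  - by move=> p /sub /orP[/mem_intervals_bounds[]|/mem_intervals_bounds[]]; lia.
  rewrite eg' map_cat sumn_cat /= in eg.
  rewrite eg' fintervals_cat in sub.
  exists g1, g3; split=> //.
    apply: (IHl k) => [|p pg1]; first by lia.
    have := sub p; rewrite mem_cat pg1 => /(_ isT) /orP[//|/mem_intervals_bounds[]].
    by have [] := mem_fintervals_bounds pg1; lia.
  apply: (IHr (k + nleaves l)) => [|p pg3]; first by lia.
  rewrite eg1 in sub.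
  have := sub p; rewrite mem_cat pg3 orbT => /(_ isT) /orP[/mem_intervals_bounds[]|//].
  by have [] := mem_fintervals_bounds pg3; lia.
case: f => [|t [|u f]] ef sub.
- by have := nleaves_gt0 (Node l r); rewrite -ef.
- case: t ef sub => [|tl tr] ef.
    by move: ef => /=; have := nleaves_gt0 l; have := nleaves_gt0 r; lia.
  rewrite fintervals1 => sub.
  (* For a single tree, [many] applies to its two children; the parts can only be [[:: tl]] and
     [[:: tr]], whence [tl = l] and [tr = r]. *)
  have [//|||g1 [g2 [eg c1 c2]]] := many [:: tl; tr].
  + by rewrite -ef /= !addn0.
  + move=> p; rewrite /= cats0 => pt; apply: sub.
    by rewrite intervals_node inE pt orbT.
  have := cut_nnil c1; have := cut_nnil c2.
  case: g1 eg c1 => [|t1 [|t2 g1]] //= [-> eg]; last by case: g1 g2 eg {c2} => [|? ?] [].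
  by move=> /cut1-> _ _; move: c2; rewrite -eg => /cut1->; apply: cut_one.
- have [//|//|//|g1 [g2 [-> c1 c2]]] := many [:: t, u & f].
  exact: cut_node.
Qed.

(** * The lattice of cuts *)

(** Sizes serve the Tamari order, intervals the comb order. The offset [k] is arbitrary so that
    forests can be shifted when concatenated. *)
Definition is_inter f1 f2 m :=
  (forall i, nth 0 (fsizes m) i = minn (nth 0 (fsizes f1) i) (nth 0 (fsizes f2) i))
  /\ forall k (p : nat * nat),
       (p \in fintervals k m) = (p \in fintervals k f1) && (p \in fintervals k f2).

Definition is_union f1 f2 j :=
  (forall i, nth 0 (fsizes j) i = maxn (nth 0 (fsizes f1) i) (nth 0 (fsizes f2) i))
  /\ forall k (p : nat * nat),
       (p \in fintervals k j) = (p \in fintervals k f1) || (p \in fintervals k f2).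

Lemma is_interC f1 f2 m : is_inter f1 f2 m -> is_inter f2 f1 m.
Proof. by case=> sz iv; split=> [i|k p]; rewrite ?sz ?iv (minnC, andbC). Qed.

Lemma is_unionC f1 f2 j : is_union f1 f2 j -> is_union f2 f1 j.
Proof. by case=> sz iv; split=> [i|k p]; rewrite ?sz ?iv (maxnC, orbC). Qed.

Lemma cut_one_inter t f : cut f t -> is_inter [:: t] f f.
Proof.
move=> c; split=> [i|k p]; first by rewrite (minn_idPr (cut_fsizes_le c i)).
rewrite fintervals1; case pf: (p \in fintervals k f); last by rewrite andbF.
by rewrite (cut_fintervals c pf).
Qed.

Lemma cut_one_union t f : cut f t -> is_union [:: t] f [:: t].
Proof.
move=> c; split=> [i|k p]; first by rewrite (maxn_idPl (cut_fsizes_le c i)).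
rewrite fintervals1; case pf: (p \in fintervals k f); last by rewrite orbF.
by rewrite (cut_fintervals c pf).
Qed.

(** Equal leaf counts align the block boundaries, so no interval from the left block of one forest
    occurs in the right block of the other. *)
Lemma cat_inter f1 g1 f2 g2 mf mg :
    fleaves f1 = fleaves f2 -> fleaves mf = fleaves f1 ->
  is_inter f1 f2 mf -> is_inter g1 g2 mg ->
  is_inter (f1 ++ g1) (f2 ++ g2) (mf ++ mg).
Proof.
move=> e2 em [szf ivf] [szg ivg]; split=> [i|k p].
  by rewrite !fsizes_cat !nth_cat !size_fsizes em e2; case: ifP.
rewrite !fintervals_cat !mem_cat ivf ivg em e2.
have no_both f g : fleaves f = fleaves f2 -> p \in fintervals k f ->
    p \in fintervals (k + fleaves f2) g -> False.
  by move=> ef /mem_fintervals_bounds[? ? ?] /mem_fintervals_bounds[? ? ?]; lia.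
case pf1: (p \in fintervals k f1); case pf2: (p \in fintervals k f2) => //=.
- case pg2: (p \in fintervals _ g2); last by rewrite andbF.
  by case: (no_both _ _ e2 pf1 pg2).
- case pg1: (p \in fintervals _ g1) => //.
  by case: (no_both _ _ erefl pf2 pg1).
Qed.

Lemma cat_union f1 g1 f2 g2 jf jg :
    fleaves f1 = fleaves f2 -> fleaves jf = fleaves f1 ->
  is_union f1 f2 jf -> is_union g1 g2 jg ->
  is_union (f1 ++ g1) (f2 ++ g2) (jf ++ jg).
Proof.
move=> e2 ej [szf ivf] [szg ivg]; split=> [i|k p].
  by rewrite !fsizes_cat !nth_cat !size_fsizes ej e2; case: ifP.
by rewrite !fintervals_cat !mem_cat ivf ivg ej e2 orbACA.
Qed.

(** If one cut is the whole tree, it is the larger one; otherwise both split at the root, and the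
    results for the two children are concatenated. *)
Lemma cut_lattice t f1 f2 : cut f1 t -> cut f2 t ->
  exists m j, [/\ cut m t, cut j t, is_inter f1 f2 m & is_union f1 f2 j].
Proof.
move=> c1; elim: c1 f2 => [{}t f2 c2|{}f1 g1 l r cf1 IHf cg1 IHg f2 /[dup] c /cut_inv].
  exists f2, [:: t]; split=> //; first exact: cut_one.
    exact: cut_one_inter.
  exact: cut_one_union.
case=> [->|[f [g [-> cf cg]]]].
  have c12 := cut_node cf1 cg1.
  exists (f1 ++ g1), [:: Node l r]; split=> //; first exact: cut_one.
    exact/is_interC/cut_one_inter.
  exact/is_unionC/cut_one_union.
have [mf [jf [cmf cjf imf ujf]]] := IHf f cf.
have [mg [jg [cmg cjg img ujg]]] := IHg g cg.
have efl := (cut_fleaves cf1, cut_fleaves cf, cut_fleaves cmf, cut_fleaves cjf).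
exists (mf ++ mg), (jf ++ jg); split; try exact: cut_node.
  by apply: cat_inter => //; rewrite !efl.
by apply: cat_union => //; rewrite !efl.
Qed.

(** * The forest along the right spine *)

(** Deletes the internal vertices of the right spine: these and the last leaf are the vertices above
    or at the last leaf, which stays as a tree of its own. *)
Fixpoint spine (t : bintree) : seq bintree :=
  if t is Node l r then l :: spine r else [:: Leaf].

Lemma fsizes_spine t : fsizes (spine t) = rcons (left_sizes t) 1.
Proof.
by elim: t => //= l _ r; rewrite /fsizes /= => ->; rewrite rcons_cat cat_rcons.
Qed.

Lemma fleaves_spine t : fleaves (spine t) = nleaves t.
Proof. by elim: t => //= l _ r ->. Qed.

(** The last entry of [fsizes f] is the size of the last tree, which is therefore a leaf; the other
    trees are hung on a right spine ending there. *)
Lemma spine_surj f : 0 < size f -> last 0 (fsizes f) = 1 -> exists t, spine t = f.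
Proof.
case/lastP: f => // f u _.
rewrite -cats1 fsizes_cat {2}/fsizes /= cats0 -rcons_cat last_rcons => /nleaves_eq1->.
elim: f => [|l f [r er]]; first by exists Leaf.
by exists (Node l r); rewrite /= er.
Qed.

Lemma last_leaf_interval k t : ((k + nleaves t).-1, 1) \in intervals k t.
Proof.
elim: t k => [|l _ r IH] k; first by rewrite addn1 inE.
by rewrite intervals_node inE mem_cat /= addnA IH !orbT.
Qed.

Lemma mem_fintervals_spine k t (p : nat * nat) : (p \in fintervals k (spine t)) =
  (p \in intervals k t) && (p.1 + p.2 < k + nleaves t) || (p == ((k + nleaves t).-1, 1)).
Proof.
elim: t k => [|l _ r IH] k.
  rewrite fintervals1 /= addn1 /= inE; case: eqP => [->|] //=.
  by rewrite orbT.
rewrite [LHS]mem_cat IH intervals_node inE mem_cat /= addnA.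
have lr := nleaves_gt0 r.
case pl: (p \in intervals k l) => /=.
  have [_ _ le] := mem_intervals_bounds pl; rewrite orbT.
  by have -> : p.1 + p.2 < k + nleaves l + nleaves r by lia.
have [->|//] := eqVneq p (k, nleaves l + nleaves r).
by rewrite /= !addnA ltnn !andbF.
Qed.

(** * The comb order as inclusion of interval families *)

Definition interval_set n (p : nat * nat) : {set 'I_n} :=
  [set i : 'I_n | p.1 <= i < p.1 + p.2].

Lemma interval_set_sub n (p q : nat * nat) : 0 < p.2 -> p.1 + p.2 <= n ->
  interval_set n p \subset interval_set n q -> q.1 <= p.1 /\ p.1 + p.2 <= q.1 + q.2.
Proof.
move=> p0 pn /subsetP sub.
(* It suffices to test the inclusion at the first and last element of [p]. *)
have lt1 : p.1 < n by lia.
have lt2 : (p.1 + p.2).-1 < n by lia.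
have := sub (Ordinal lt1); have := sub (Ordinal lt2); rewrite !inE /=.
by move=> /(_ ltac:(lia)) ? /(_ ltac:(lia)) ?; split; lia.
Qed.

Lemma interval_set_inj n (p q : nat * nat) :
    0 < p.2 -> p.1 + p.2 <= n -> 0 < q.2 -> q.1 + q.2 <= n ->
  interval_set n p = interval_set n q -> p = q.
Proof.
move=> p0 pn q0 qn epq.
have [le1 le2] := @interval_set_sub n p q p0 pn ltac:(by rewrite epq).
have [ge1 ge2] := @interval_set_sub n q p q0 qn ltac:(by rewrite epq).
by rewrite [p]surjective_pairing [q]surjective_pairing; congr (_, _); lia.
Qed.

Section CombOrder.
Variable n : nat.
Implicit Types T : ptree n.

(** A nonempty interval within the [n] leaves avoids the last one exactly when it ends strictly
    before [n]. *)
Lemma RP_P T (S : {set 'I_n}) : reflect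
  (exists p : nat * nat,
     [/\ p \in intervals 0 (val T), p.1 + p.2 < n & S = interval_set n p])
  (S \in RP T).
Proof.
have -> : (S \in RP T) =
    (S \in [seq interval_set n p | p <- intervals 0 (val T)])
    && [forall i in S, i.+1 != n].
  by rewrite inE -map_comp.
have bnd (p : nat * nat) : p \in intervals 0 (val T) -> 0 < p.2 /\ p.1 + p.2 <= n.
  by move=> /mem_intervals_bounds[_ ? +]; rewrite (eqP (valP T)) add0n.
apply: (iffP andP) => [[/mapP[p pT ->] /forall_inP notn]|[p [pT lt_pn ->]]].
  exists p; split=> //; move: (p : nat * nat) pT notn => {}p /bnd[p0 pn] notn.
  rewrite ltn_neqAle pn andbT; apply/eqP => epn.
  have lt : (p.1 + p.2).-1 < n by lia.
  by have := notn (Ordinal lt); rewrite inE /= => /(_ ltac:(lia)) /eqP; lia.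
split; first exact: map_f.
by apply/forall_inP => i; rewrite inE => /andP[_ lt]; apply/eqP; lia.
Qed.

(** Sets determine their intervals by [interval_set_inj], and the singleton of the last leaf belongs
    to both spine forests. *)
Lemma comb_leP T T' : comb_le T T' <->
  {subset fintervals 0 (spine (val T)) <= fintervals 0 (spine (val T'))}.
Proof.
have nT (U : ptree n) : nleaves (val U) = n by apply/eqP/(valP U).
have bnd (U : ptree n) (p : nat * nat) : p \in intervals 0 (val U) -> 0 < p.2 /\ p.1 + p.2 <= n.
  by move=> /mem_intervals_bounds[_ ? +]; rewrite nT add0n.
split=> [/subsetP sub p|sub].
  rewrite !mem_fintervals_spine !nT => /orP[/andP[pT lt]|->]; last by rewrite orbT.
  have /RP_P[q [qT' _ epq]] : interval_set n p \in RP T'.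
    by apply: sub; apply/RP_P; exists p.
  have [? ?] := bnd _ _ pT; have [? ?] := bnd _ _ qT'.
  by rewrite (@interval_set_inj n p q) // qT' -(@interval_set_inj n p q) // lt.
apply/subsetP => S /RP_P[p [pT lt ->]]; apply/RP_P; exists p; split=> //.
have := sub p; rewrite !mem_fintervals_spine !nT pT add0n lt /= => /(_ isT).
by case/orP=> [/andP[]//|/eqP ep]; move: lt; rewrite ep /=; lia.
Qed.

Lemma comb_le_cut T T' : comb_le T T' -> cut (spine (val T)) (val T').
Proof.
move=> /comb_leP sub; apply: (@fintervals_cut 0).
  by rewrite fleaves_spine (eqP (valP T)) (eqP (valP T')).
move=> p /sub; rewrite mem_fintervals_spine => /orP[/andP[]//|/eqP->].
exact: last_leaf_interval.
Qed.

(** The spine forest of [T] is a cut of [T'], and cutting lowers sizes. Antisymmetry of the comb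
    order follows from this. *)
Lemma comb_le_tamari_le T T' : comb_le T T' -> tamari_le T T'.
Proof.
move=> /comb_le_cut/cut_fsizes_le le; apply/tamari_leP => i; move: (le i).
rewrite fsizes_spine /fsizes /= cats0 !nth_rcons !size_left_sizes_ptree.
by case: ltnP => // ge _; rewrite nth_default ?size_left_sizes_ptree.
Qed.

Lemma comb_le_anti T T' : comb_le T T' -> comb_le T' T -> T = T'.
Proof. by move=> /comb_le_tamari_le le /comb_le_tamari_le; apply: tamari_le_anti. Qed.

(** Position [n.-1] is the last leaf; entry 1 there makes it a tree of its own, as [spine_surj]
    requires. *)
Lemma cut_spine (B : ptree n) f : cut f (val B) -> nth 0 (fsizes f) n.-1 = 1 ->
  exists T, spine (val T) = f.
Proof.
move=> c f1; have sf := cut_fleaves c; have nB := eqP (valP B).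
have [|t et] := spine_surj (cut_nnil c).
  by rewrite -nth_last size_fsizes sf nB.
have nt : nleaves t == n by rewrite -fleaves_spine et sf nB.
by exists (exist _ t nt).
Qed.

End CombOrder.

(** * Meets and joins in both orders *)

Lemma unique_meet (X : Type) (le : X -> X -> Prop) x y m :
    (forall a b, le a b -> le b a -> a = b) ->
  is_meet le x y m -> unique (is_meet le x y) m.
Proof.
move=> anti mP; split=> // m' [m'x m'y m'P]; case: mP => mx my mP.
by apply: anti; [apply: m'P|apply: mP].
Qed.

Lemma unique_join (X : Type) (le : X -> X -> Prop) x y j :
    (forall a b, le a b -> le b a -> a = b) ->
  is_join le x y j -> unique (is_join le x y) j.
Proof.
move=> anti jP; split=> // j' [j'x j'y j'P]; case: jP => jx jy jP.
by apply: anti; [apply: jP|apply: j'P].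
Qed.

Lemma nth_fsizes_spine n (T : ptree n) i :
  nth 0 (fsizes (spine (val T))) i =
  if i == n.-1 then 1 else nth 0 (left_sizes (val T)) i.
Proof.
rewrite fsizes_spine nth_rcons size_left_sizes_ptree; case: ltngtP => // lt.
by rewrite nth_default // size_left_sizes_ptree ltnW.
Qed.

Theorem corollary5p4 (n : nat) (hn : 2 <= n) (T1 T2 A B : ptree n)
  (hA1 : comb_le A T1) (h1B : comb_le T1 B)
  (hA2 : comb_le A T2) (h2B : comb_le T2 B) :
  (exists M : ptree n,
      unique (is_meet (@comb_le n) T1 T2) M /\
      unique (is_meet (@tamari_le n) T1 T2) M) /\
  (exists J : ptree n,
      unique (is_join (@comb_le n) T1 T2) J /\
      unique (is_join (@tamari_le n) T1 T2) J).
Proof.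
have [m [j [cm cj [szm ivm] [szj ivj]]]] :=
  cut_lattice (comb_le_cut h1B) (comb_le_cut h2B).
(* Both spine forests have entry 1 at the last leaf, hence so do the minimum and the maximum. *)
have [|M eM] := cut_spine cm; first by rewrite szm !nth_fsizes_spine eqxx.
have [|J eJ] := cut_spine cj; first by rewrite szj !nth_fsizes_spine eqxx.
have lsM i : nth 0 (left_sizes (val M)) i =
    minn (nth 0 (left_sizes (val T1)) i) (nth 0 (left_sizes (val T2)) i).
  (* At [n.-1], past the end of [left_sizes], all three entries are the default 0. *)
  have := szm i; rewrite -eM !nth_fsizes_spine; case: eqP => // -> _.
  by rewrite !nth_default ?size_left_sizes_ptree.
have lsJ i : nth 0 (left_sizes (val J)) i =
    maxn (nth 0 (left_sizes (val T1)) i) (nth 0 (left_sizes (val T2)) i).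
  have := szj i; rewrite -eJ !nth_fsizes_spine; case: eqP => // -> _.
  by rewrite !nth_default ?size_left_sizes_ptree.
(* The comb claims are read off from the interval families, the Tamari claims from the sizes. *)
split; [exists M|exists J]; split.
- apply: unique_meet; first exact: comb_le_anti.
  split=> [||Z /comb_leP Z1 /comb_leP Z2]; apply/comb_leP => p; rewrite eM ivm.
  + by case/andP.
  + by case/andP.
  + by move=> pZ; rewrite Z1 ?Z2.
- apply: unique_meet; first exact: tamari_le_anti.
  split=> [||Z /tamari_leP Z1 /tamari_leP Z2]; apply/tamari_leP => i; rewrite lsM.
  + exact: geq_minl.
  + exact: geq_minr.
  + by rewrite leq_min Z1 Z2.
- apply: unique_join; first exact: comb_le_anti.
  split=> [||Z /comb_leP Z1 /comb_leP Z2]; apply/comb_leP => p; rewrite eJ ivj.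
  + by move->.
  + by move->; rewrite orbT.
  + by case/orP=> [/Z1|/Z2].
- apply: unique_join; first exact: tamari_le_anti.
  split=> [||Z /tamari_leP Z1 /tamari_leP Z2]; apply/tamari_leP => i; rewrite lsJ.
  + exact: leq_maxl.
  + exact: leq_maxr.
  + by rewrite geq_max Z1 Z2.
Qed.
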